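(* Let $I$ be any nonzero fractional ideal in a totally real number field $K$. Then $\kappa(I)$ is at most the number of classes of $I$-indecomposables modulo multiplication by totally positive units of $\mathcal{O}_K$. In particular, $\kappa(I)$ is finite.
   Context: Let $K$ be a totally real number field with ring of integers $\mathcal{O}_K$. An element of $K$ is totally positive if all its images under the real embeddings of $K$ are positive. For a subset $J\subseteq K$, $J^+$ is the set of totally positive elements of $J$, and $J^{+,0}=J^+\cup\{0\}$. For a nonzero fractional ideal $I$ of $\mathcal{O}_K$, $\kappa(I)$ is the smallest number $n$ such that there exist $\alpha_1,\dots,\alpha_n\in K^+$ with $$I^{+,0}=\alpha_1\mathcal{O}_K^{+,0}+\dots+\alpha_n\mathcal{O}_K^{+,0}$$ (a priori $\kappa(I)=\infty$ if no such $n$ exists). An element $\alpha\in I^+$ is called $I$-indecomposable if it cannot be written as $\alpha=\beta+\gamma$ with $\beta,\gamma\in I^+$. The group of totally positive units of $\mathcal{O}_K$ acts on the set of $I$-indecomposables by multiplication; classes are the orbits of this action. *)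

(* Defs.v *)
From HB Require Import structures.
From mathcomp Require Import all_boot all_order all_algebra all_field.
From mathcomp Require Import boolp classical_sets functions cardinality.
From mathcomp Require Import constructive_ereal.
From mathcomp Require finmap.
Set Implicit Arguments.
Unset Strict Implicit.
Unset Printing Implicit Defensive.
Import Order.TTheory GRing.Theory Num.Theory.
Import finmap.
Local Open Scope classical_set_scope.
Local Open Scope ring_scope.

(* A number field is a [fieldExtType rat].  The image of an embedding of a
   number field in the complex numbers consists of algebraic numbers, so the
   complex embeddings are the ring morphisms to [algC]. *)
Definition real_embedding (K : fieldExtType rat)
    (s : {rmorphism K -> algC}) : Prop :=
  forall x : K, s x \is Num.real.

Definition totally_real (K : fieldExtType rat) : Prop :=
  forall s : {rmorphism K -> algC}, real_embedding s.

Definition totally_positive (K : fieldExtType rat) (x : K) : Prop :=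
  forall s : {rmorphism K -> algC}, real_embedding s -> 0 < s x.

Definition ring_of_integers (K : fieldExtType rat) : set K :=
  [set x | integralOver (intr : int -> K) x].

(* J^+ *)
Definition pos_part (K : fieldExtType rat) (J : set K) : set K :=
  [set x | J x /\ totally_positive x].

(* J^{+,0} *)
Definition pos_part0 (K : fieldExtType rat) (J : set K) : set K :=
  pos_part J `|` [set 0].

Record nonzero_fractional_ideal (K : fieldExtType rat) (I : set K) : Prop := {
  fideal_0 : I 0;
  fideal_add : forall x y : K, I x -> I y -> I (x + y);
  fideal_mul : forall a x : K, ring_of_integers a -> I x -> I (a * x);
  fideal_denominator : exists d : K,
    [/\ ring_of_integers d, d != 0 &
        forall x : K, I x -> ring_of_integers (d * x)];
  fideal_nonzero : exists2 x : K, I x & x != 0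
}.

(* alpha_1 O_K^{+,0} + ... + alpha_n O_K^{+,0} *)
Definition pos_combinations (K : fieldExtType rat) (n : nat)
    (alpha : 'I_n -> K) : set K :=
  [set x | exists2 b : 'I_n -> K,
     (forall i, pos_part0 (@ring_of_integers K) (b i)) &
     x = \sum_(i < n) alpha i * b i].

Definition pos_generated (K : fieldExtType rat) (I : set K) (n : nat) : Prop :=
  exists2 alpha : 'I_n -> K,
    (forall i, totally_positive (alpha i)) &
    pos_part0 I = pos_combinations alpha.

(* The type [\bar int] is used for natural numbers extended by [+oo]. *)
Definition kappa (K : fieldExtType rat) (I : set K) : \bar int :=
  match pselect (exists n : nat, `[< pos_generated I n >]) with
  | left ex_n => (Posz (ex_minn ex_n))%:E
  | right _ => +oo%E
  end.

Definition indecomposable (K : fieldExtType rat) (I : set K) (a : K) : Prop :=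
  pos_part I a /\
  ~ exists b c : K, [/\ pos_part I b, pos_part I c & a = b + c].

Definition pos_units (K : fieldExtType rat) : set K :=
  [set e | [/\ ring_of_integers e, ring_of_integers e^-1
             & totally_positive e]].

Definition pos_unit_orbit (K : fieldExtType rat) (a : K) : set K :=
  [set e * a | e in @pos_units K].

Definition indecomposable_classes (K : fieldExtType rat) (I : set K) :
    set (set K) :=
  [set pos_unit_orbit a | a in indecomposable I].

Definition ecard (T : choiceType) (A : set T) : \bar int :=
  if pselect (finite_set A) then (Posz #|` fset_set A|%fset)%:E else +oo%E.

(* Main.v *)
Require Import Defs.
From HB Require Import structures.
From mathcomp Require Import all_boot all_order all_algebra all_field.
From mathcomp Require Import boolp classical_sets functions cardinality.
From mathcomp Require Import constructive_ereal.
Set Implicit Arguments.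
Unset Strict Implicit.
Unset Printing Implicit Defensive.
Import Order.TTheory GRing.Theory Num.Theory.
Local Open Scope classical_set_scope.
Local Open Scope ring_scope.

(* If [x] in [I^+] has large norm, the pigeonhole principle yields a nonzero
   integer [y] of [K] with [s(a) s(y)^2 < s(x)] for every embedding [s], where
   [a] in [I^+] is fixed; then [x = a y^2 + (x - a y^2)] is decomposable.  So
   indecomposables have bounded norm, and up to totally positive units there
   are finitely many elements of bounded norm.  Since the trace is positive and
   has bounded denominator on [I^+], every element of [I^+] is a sum of
   indecomposables, hence a combination, with totally positive units as
   coefficients, of representatives of the classes. *)

(** * Integral primitive elements and complex embeddings *)

Lemma common_denominator (T : finType) (f : T -> rat) :
  exists2 n : int, n != 0 & exists m : T -> int, forall i, n%:Q * f i = (m i)%:Q.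
Proof.
exists (\prod_i denq (f i)).
  by apply/prodf_neq0 => i _; apply: denq_neq0.
exists (fun i => \prod_(j | j != i) denq (f j) * numq (f i)) => i.
rewrite (bigD1 i) //= -[X in _ * X = _]divq_num_den mulrC.
by rewrite !intrM mulrA divfK ?intr_eq0 ?denq_neq0 // mulrC.
Qed.

(* A multiple [k x] acts on the [e j] by an integer matrix, and is a root of its
   characteristic polynomial. *)
Lemma span_integral_multiple (K : fieldExtType rat) (n : nat) (e : 'I_n -> K)
    (x : K) :
    (forall y, exists w : 'I_n -> rat, y = \sum_j w j *: e j) ->
  exists2 k : int, k != 0 & ring_of_integers (k%:~R * x).
Proof.
move=> spane.
have [W WP] := choice (fun i => spane (x * e i)).
have [k k0 [m mP]] :=
  common_denominator (fun ij : 'I_n * 'I_n => W ij.1 ij.2).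
exists k => //.
(* The transpose, because eigenvectors are rows here: the row of the [e j], multiplied by [A] on the
   right, becomes [k x] times itself. *)
pose A : 'M[int]_n := \matrix_(i, j) m (j, i).
exists (char_poly A); first exact: char_poly_monic.
rewrite (map_char_poly (intr : {rmorphism int -> K})) -eigenvalue_root_char.
apply/eigenvalueP; exists (\row_j e j).
  apply/rowP => i; rewrite !mxE -mulrA WP mulr_sumr; apply: eq_bigr => j _.
  have := congr1 (in_alg K) (mP (i, j)); rewrite rmorphM !rmorph_int /= => kW.
  by rewrite !mxE -kW mulrC -[W i j *: e j]mulr_algl mulrA.
apply/eqP => /rowP e0; have [w] := spane 1.
rewrite big1 => [/eqP|j _]; first by rewrite oner_eq0.
by have := e0 j; rewrite !mxE => ->; rewrite scaler0.
Qed.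

(** Characteristic zero makes [K] separable, hence simple. Scaling the generator by an integer makes
    it integral, and substituting a scaled ['X] in the polynomials compensates. *)
Lemma num_field_primitive (K : fieldExtType rat) :
  exists2 z : K, ring_of_integers z &
    forall x, exists p : {poly rat}, x = (map_poly (in_alg K) p).[z].
Proof.
have [z zP] : exists z : K, forall x,
    exists p : {poly rat}, x = (map_poly (in_alg K) p).[z].
  have sepK : separable (1%AS : {subfield K}) (aspacef K).
    apply/separableP => y _; apply: pcharf0_separable => p.
    by rewrite (fmorph_pchar (in_alg K)); apply: pchar_num.
  exists (separable_generator 1%AS (aspacef K)) => x; apply/Fadjoin1_polyP.
  by rewrite -(eq_adjoin_separable_generator sepK (subvf _)) memvf.
have [|k k0 kz_int] := @span_integral_multiple K _ (tnth (vbasis {:K})) z.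
  move=> y; exists (fun i => coord (vbasis {:K}) i y).
  rewrite {1}(coord_vbasis (memvf y)); apply: eq_bigr => i _.
  by rewrite (tnth_nth 0).
exists (k%:~R * z) => // x; have [p ->] := zP x.
exists (p \Po (k%:Q^-1 *: 'X)).
rewrite map_comp_poly horner_comp linearZ /= map_polyX hornerZ hornerX.
congr (_.[_]); rewrite mulrA -(rmorph_int (in_alg K) k) -[_%:A]/(in_alg K _).
by rewrite -rmorphM mulVf ?intr_eq0 // rmorph1 mul1r.
Qed.

(** Evaluation at [z] presents [K] as a quotient of the polynomial ring, so evaluation at [r]
    descends to [K] once it kills the same kernel. *)
Lemma num_field_emb (K : fieldExtType rat) (z : K) (r : algC) :
    (forall x, exists p : {poly rat}, x = (map_poly (in_alg K) p).[z]) ->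
    (forall p : {poly rat}, (map_poly (in_alg K) p).[z] = 0 ->
       (map_poly ratr p).[r] = 0) ->
  exists s : {rmorphism K -> algC}, s z = r.
Proof.
move=> zP zr; have [P PE] := choice zP.
pose s (x : K) : algC := (map_poly ratr (P x)).[r].
(* Any polynomial representing [x] may replace the chosen [P x]; both morphism laws follow from
   this. *)
have sE p x : x = (map_poly (in_alg K) p).[z] -> s x = (map_poly ratr p).[r].
  move=> xE; apply/eqP; rewrite -subr_eq0 -hornerN -hornerD -rmorphB zr //.
  by rewrite rmorphB hornerD hornerN -xE -PE subrr.
have sB : zmod_morphism s.
  move=> x y; rewrite (sE (P x - P y)) ?rmorphB ?hornerD ?hornerN //.
  by rewrite -!PE.
have sM : monoid_morphism s.
  split=> [|x y]; first by rewrite (sE 1) ?rmorph1 ?hornerC.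
  by rewrite (sE (P x * P y)) ?rmorphM ?hornerM // -!PE.
pose sA := GRing.isZmodMorphism.Build _ _ s sB.
pose sR := GRing.isMonoidMorphism.Build _ _ s sM.
pose S : {rmorphism K -> algC} := HB.pack s sA sR.
by exists S; rewrite /= (sE 'X) ?map_polyX ?hornerX.
Qed.

(** The [e j] need not generate the whole ring of integers. Invertibility of the matrix makes them
    linearly independent and the [s i] distinct. *)
Record embedding_basis (K : fieldExtType rat) (n : nat) (e : 'I_n -> K)
    (s : 'I_n -> {rmorphism K -> algC}) : Prop := {
  basis_int : forall j, ring_of_integers (e j);
  basis_span : forall x, exists w : 'I_n -> rat, x = \sum_j w j *: e j;
  emb_complete : forall t : {rmorphism K -> algC}, exists i, t =1 s i;
  emb_unitmx : \matrix_(i, j) s i (e j) \in unitmx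
}.

(** Take the powers of an integral primitive element and the embeddings sending it to the roots of
    its minimal polynomial. These roots are distinct, so the Vandermonde determinant is nonzero. *)
Lemma embedding_basis_exists (K : fieldExtType rat) :
  exists n (e : 'I_n -> K) s, embedding_basis e s.
Proof.
have [z z_int zP] := num_field_primitive K.
have /polyOver1P[q qE] := minPolyOver 1%AS z.
have q_monic : q \is monic by rewrite -(map_monic (in_alg K)) -qE monic_minPoly.
have qz : (map_poly (in_alg K) q).[z] = 0 by rewrite -qE minPolyxx.
have q_dvd p : (map_poly (in_alg K) p).[z] = 0 -> q %| p.
  move=> pz; rewrite -(dvdp_map (in_alg K)) -qE minPoly_dvdp //; last exact/rootP.
  by apply/polyOver1P; exists p.
have q_sep : separable_poly q.
  rewrite -(separable_map (in_alg K)) -qE; apply: pcharf0_separable => p.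
  by rewrite (fmorph_pchar (in_alg K)); apply: pchar_num.
have [r rE] := closed_field_poly_normal (map_poly ratr q : {poly algC}).
rewrite lead_coef_map (monicP q_monic) rmorph1 scale1r in rE.
have r_uniq : uniq r by rewrite -separable_prod_XsubC -rE separable_map.
pose n := size r.
have q_size : size q = n.+1.
  by rewrite -(size_map_poly (ratr : {rmorphism rat -> algC})) rE size_prod_XsubC.
have embP (i : 'I_n) : exists s : {rmorphism K -> algC}, s z = r`_i.
  apply: num_field_emb zP _ => p /q_dvd /dvdpP[p' ->].
  have /rootP qr0 : root (map_poly ratr q) r`_i.
    by rewrite rE root_prod_XsubC mem_nth.
  by rewrite rmorphM hornerM /= qr0 mulr0.
have [s sE] := choice embP.
exists n, (fun j => z ^+ j), s; split => [j|x|t|].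
- elim: (j : nat) => [|k IHk]; first by rewrite expr0; apply: integral1.
  by rewrite exprS; apply: integral_mul.
- have [p ->] := zP x; exists (fun j => (p %% q)`_j).
  rewrite {1}(divp_eq p q) rmorphD rmorphM hornerD hornerM qz mulr0 add0r.
  rewrite (@horner_coef_wide _ n) => [|]; last first.
    by rewrite size_map_poly -ltnS -q_size ltn_modp monic_neq0.
  by apply: eq_bigr => j _; rewrite coef_map /= mulr_algl.
- have : t z \in r.
    rewrite -root_prod_XsubC -rE; apply/rootP/eqP.
    have := congr1 t qz; rewrite -horner_map -map_poly_comp rmorph0 => <-.
    apply/eqP; congr _.[_]; apply: eq_map_poly => c /=.
    by rewrite alg_num_field fmorph_rat.
  move=> /(nthP 0)[i ir tz]; exists (Ordinal ir) => x; have [p ->] := zP x.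
  rewrite -!horner_map sE tz -!map_poly_comp; congr _.[_].
  by apply: eq_map_poly => c /=; rewrite alg_num_field !fmorph_rat.
- have -> : \matrix_(i, j) s i (z ^+ j) = (Vandermonde n (\row_(i < n) r`_i))^T.
    by apply/matrixP => i j; rewrite !mxE rmorphXn sE.
  rewrite unitmx_tr unitmxE det_Vandermonde unitfE.
  apply/prodf_neq0 => i _; apply/prodf_neq0 => j ij.
  by rewrite !mxE subr_eq0 nth_uniq // gtn_eqF.
Qed.

(** * Small integer combinations by the pigeonhole principle *)

Lemma truncn_eq_dist (R : archiNumFieldType) (x y : R) :
  0 <= x -> 0 <= y -> Num.truncn x = Num.truncn y -> `|x - y| < 1.
Proof.
move=> x0 y0 xy; have /andP[] := truncn_itv x0; have /andP[] := truncn_itv y0.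
rewrite -xy -natr1 => yl yr xl xr.
rewrite real_ltr_distl ?rpredB ?ger0_real // ltrBlDr.
by rewrite (lt_le_trans yr) ?(lt_le_trans xr) // lerD2r.
Qed.

(* Pigeonhole: for [M] large, the [(M + 1)^n] vectors with entries in
   [{0, ..., M}] have images in a box of half-width [A M], which is covered by
   fewer than [M^n] cells of sides [t i]. *)
Lemma small_integer_combination (R : archiNumFieldType) (n : nat)
    (L : 'I_n -> 'I_n -> R) :
    (forall i j, L i j \is Num.real) ->
  exists C : nat, forall t : 'I_n -> R, (forall i, 0 < t i) ->
    C%:R < \prod_i t i ->
  exists2 c : 'I_n -> int, (exists j, c j != 0) &
    forall i, `|\sum_j (c j)%:~R * L i j| < t i.
Proof.
move=> Lreal.
pose A := Num.bound (\sum_i \sum_j `|L i j|).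
have LA i : \sum_j `|L i j| <= A%:R.
  apply: ltW; apply: le_lt_trans (archi_boundP _); last first.
    by do 2!apply: sumr_ge0 => ? _.
  by rewrite [leRHS](bigD1 i) //= lerDl sumr_ge0 // => k _; apply: sumr_ge0.
have A0 : 0 < A%:R :> R.
  apply: le_lt_trans (archi_boundP _); last by do 2!apply: sumr_ge0 => ? _.
  by do 2!apply: sumr_ge0 => ? _.
(* In direction [i] at most [2 A M / t i + 1] cells are met, which is at most [3 A M / t i] since
   [t i <= M] and [1 <= A]. The product over [i] is below [M ^ n] once [\prod_i t i] exceeds
   [(3 A) ^ n]. *)
exists ((3 * A) ^ n)%N => t t0 Ct.
pose M := Num.bound (\sum_i t i).
have tM i : t i <= M%:R.
  apply: ltW; apply: le_lt_trans (archi_boundP _); last first.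
    by apply: sumr_ge0 => ? _; apply: ltW.
  by rewrite [leRHS](bigD1 i) //= lerDl sumr_ge0 // => k _; apply: ltW.
have M0 : 0 < M%:R :> R.
  apply: le_lt_trans (archi_boundP _); last by apply: sumr_ge0 => ? _; apply: ltW.
  by apply: sumr_ge0 => ? _; apply: ltW.
have A1 : 1 <= A%:R :> R by move: A0; rewrite ltr0n ler1n.
pose v (c : {ffun 'I_n -> 'I_M.+1}) i : R := \sum_j (c j)%:R * L i j.
have v_real c i : v c i \is Num.real.
  by apply: rpred_sum => j _; rewrite rpredM ?realn.
have v_bound c i : `|v c i| <= (A * M)%:R.
  apply: le_trans (ler_norm_sum _ _ _) _; rewrite natrM.
  apply: (@le_trans _ _ (\sum_j `|L i j| * M%:R)).
    apply: ler_sum => j _; rewrite normrM mulrC ler_wpM2l //.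
    by rewrite ger0_norm // ler_nat -ltnS.
  by rewrite -mulr_suml ler_wpM2r.
(* The shift by [A * M] makes the value nonnegative, so that [Num.truncn] numbers the cells. *)
pose u c i := (v c i + (A * M)%:R) / t i.
have u_ge0 c i : 0 <= u c i.
  apply: divr_ge0 (ltW (t0 i)); rewrite -lerBlDr sub0r.
  by have := v_bound c i; rewrite real_ler_norml // => /andP[].
pose w i := (2 * A * M)%:R / t i.
have u_le c i : u c i <= w i.
  rewrite ler_pM2r ?invr_gt0 // -mulnA mul2n -addnn natrD lerD2r.
  by have := v_bound c i; rewrite real_ler_norml // => /andP[].
pose m i := Num.truncn (w i).
have m_le i : (m i).+1%:R <= (3 * A)%:R * M%:R / t i.
  have w0 : 0 <= w i by rewrite divr_ge0 ?ltW.
  have /andP[mw _] := truncn_itv w0.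
  rewrite -natr1; apply: (@le_trans _ _ (w i + (A * M)%:R / t i)).
    rewrite lerD // ler_pdivlMr // mul1r natrM.
    by rewrite (le_trans (tM i)) // ler_peMl.
  rewrite -mulrDl -natrD -natrM.
  by rewrite -!mulnA -[X in (_ + X)%N]mul1n -mulnDl.
pose F c : {dffun forall i, 'I_(m i).+1} :=
  [ffun i => inord (Num.truncn (u c i))].
have /injectivePn[c [c' cc' Fcc']] : ~~ injectiveb F.
  apply/negP => /injectiveP /leq_card.
  rewrite card_ffun card_dep_ffun !card_ord foldrE big_image /= leqNgt => /negP.
  apply; rewrite -(ltr_nat R) natr_prod natrX.
  apply: (@lt_le_trans _ _ (M%:R ^+ n)); last first.
    by rewrite lerXn2r ?nnegrE ?ler_nat ?ler0n.
  apply: (@le_lt_trans _ _ (\prod_i ((3 * A)%:R * M%:R / t i))).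
    by apply: ler_prod => i _; rewrite ler0n card_ord m_le.
  rewrite prodf_div prodr_const card_ord ltr_pdivrMr ?prodr_gt0 //.
  by rewrite exprMn mulrC ltr_pM2l ?exprn_gt0 // -natrX.
exists (fun j => (c j)%:Z - (c' j)%:Z).
  have [j cj] : exists j, c j != c' j.
    apply/existsP; apply: contraNT cc' => /existsPn cc'.
    by apply/eqP/ffunP => j; apply/eqP; rewrite -[_ == _]negbK.
  by exists j; rewrite subr_eq0 eqz_nat.
move=> i; have -> : \sum_j ((c j)%:Z - (c' j)%:Z)%:~R * L i j = v c i - v c' i.
  by rewrite -sumrB; apply: eq_bigr => j _; rewrite intrB mulrBl.
have -> : v c i - v c' i = (u c i - u c' i) * t i.
  by rewrite mulrBl !divfK ?gt_eqF // opprD addrACA subrr addr0.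
rewrite normrM (gtr0_norm (t0 i)) -{2}[t i]mul1r ltr_pM2r // truncn_eq_dist //.
have := congr1 val (congr1 (fun f : {dffun _} => f i) Fcc').
by rewrite /= !ffunE /= !inordK // ltnS le_truncn.
Qed.

(** * Integrality, trace and norm through the embeddings *)

Lemma ring_of_integers_emb (K : fieldExtType rat) (t : {rmorphism K -> algC})
    (x : K) : ring_of_integers x <-> t x \in Aint.
Proof.
split=> [x_int|tx_int].
  have [p p_monic px] := integral_rmorph t x_int.
  apply: root_monic_Aint px (monic_map _ p_monic) _.
  by apply/polyOverP => i; rewrite coef_map /= rmorph_int intr_int.
(* Membership in [Aint] says that the rational minimal polynomial has integer coefficients; as [t]
   is injective, the same polynomial annihilates [x]. *)
have /floorpP[p pE] := (tx_int : minCpoly (t x) \is a polyOver Num.int).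
exists p.
  have := minCpoly_monic (t x); rewrite pE !monicE lead_coef_map_inj //.
    by move=> /eqP p1; apply/eqP; apply: (@intr_inj algC).
  exact: intr_inj.
rewrite -(fmorph_root t) -map_poly_comp.
have -> : map_poly (t \o intr) p = map_poly intr p.
  by apply: eq_map_poly => c /=; rewrite rmorph_int.
by rewrite -pE root_minCpoly.
Qed.

Section EmbeddingBasis.

Variables (K : fieldExtType rat) (n : nat) (e : 'I_n -> K).
Variable s : 'I_n -> {rmorphism K -> algC}.
Hypothesis es : embedding_basis e s.

Definition field_trace (x : K) : algC := \sum_i s i x.
Definition field_norm (x : K) : algC := \prod_i s i x.

(** If [n] were 0, then 1 would be an empty sum. Later proofs test integrality and nonvanishing
    through this one embedding. *)
Lemma emb_index : inhabited 'I_n.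
Proof.
have [w w1] := basis_span es 1; case: (pselect (inhabited 'I_n)) => // n0.
move: w1; rewrite big1 => [/eqP|i _]; first by rewrite oner_eq0.
by case: n0; constructor.
Qed.

(* [W] is the transposed matrix of multiplication by [x]. *)
Lemma diag_emb_conj (x : K) : exists W : 'M[rat]_n,
  \matrix_(i, j) s i (e j) *m map_mx ratr W =
  diag_mx (\row_i s i x) *m \matrix_(i, j) s i (e j).
Proof.
have [W WP] := choice (fun j => basis_span es (x * e j)).
exists (\matrix_(k, j) W j k); apply/matrixP => i j.
rewrite mul_diag_mx !mxE -rmorphM WP rmorph_sum.
by apply: eq_bigr => k _; rewrite !mxE rmorphZ_num mulrC.
Qed.

(** The diagonal matrix of the [s i x] is conjugate to the rational matrix [W], so both have the
    same trace. *)
Lemma field_trace_rat (x : K) : field_trace x \in Crat.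
Proof.
have [W WP] := diag_emb_conj x; have Vu := emb_unitmx es.
apply/CratP; exists (\tr W); rewrite -trace_map_mx /= -(mulKmx Vu (map_mx _ W)) WP.
rewrite mxtrace_mulC mulmxK // mxtrace_diag.
by apply: eq_bigr => i _; rewrite mxE.
Qed.

Lemma field_norm_rat (x : K) : field_norm x \in Crat.
Proof.
have [W WP] := diag_emb_conj x; have := emb_unitmx es.
rewrite unitmxE unitfE => V0; apply/CratP; exists (\det W).
rewrite -det_map_mx; apply: (mulfI V0); rewrite -det_mulmx WP det_mulmx mulrC.
by rewrite det_diag; congr (_ * _); apply: eq_bigr => i _; rewrite mxE.
Qed.

Lemma field_trace_int (x : K) : ring_of_integers x -> field_trace x \in Num.int.
Proof.
move=> x_int; apply: Cint_rat_Aint (field_trace_rat x) _.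
by apply: rpred_sum => i _; apply/ring_of_integers_emb.
Qed.

Lemma field_norm_int (x : K) : ring_of_integers x -> field_norm x \in Num.int.
Proof.
move=> x_int; apply: Cint_rat_Aint (field_norm_rat x) _.
by apply: rpred_prod => i _; apply/ring_of_integers_emb.
Qed.

(** The image of [m / x] under [s i] is the product of the other conjugates of [x], an algebraic
    integer. *)
Lemma field_norm_dvd (x : K) (m : int) : ring_of_integers x -> x != 0 ->
  field_norm x = m%:~R -> ring_of_integers (m%:~R / x).
Proof.
move=> x_int x0 xm; have [i] := emb_index.
apply/(ring_of_integers_emb (s i)); rewrite fmorph_div rmorph_int -xm.
rewrite /field_norm (bigD1 i) //= mulrC mulKf ?fmorph_eq0 //.
by apply: rpred_prod => j _; apply/ring_of_integers_emb.
Qed.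

(* [d] is the determinant of the trace form on the [e j], so that an [x] with
   all traces of [x e k] in [d m Z] has coordinates in [m Z]. *)
Lemma trace_lattice_dvd : exists2 d : int, d != 0 &
  forall (m : int) (x : K),
    (forall k, exists h : int, field_trace (x * e k) = (d * m * h)%:~R) ->
  exists2 y : K, ring_of_integers y & x = m%:~R * y.
Proof.
pose V := \matrix_(i, j) s i (e j).
have TE j k : (V^T *m V) j k = field_trace (e j * e k).
  by rewrite mxE; apply: eq_bigr => i _; rewrite !mxE rmorphM.
have /choice[T0 T0P] : forall jk : 'I_n * 'I_n,
    exists t : int, field_trace (e jk.1 * e jk.2) = t%:~R.
  by move=> [j k]; apply/intrP/field_trace_int/integral_mul; apply: basis_int es _.
pose T : 'M[int]_n := \matrix_(j, k) T0 (j, k).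
have TV : map_mx intr T = V^T *m V :> 'M[algC]_n.
  by apply/matrixP => j k; rewrite TE !mxE -T0P.
(* The Gram matrix of the trace form is [V^T *m V], so its determinant is the square of [\det V]. *)
have detT0 : \det T != 0.
  have := emb_unitmx es; rewrite unitmxE unitfE -/V => V0.
  rewrite -(intr_eq0 algC) -det_map_mx TV det_mulmx det_tr.
  by rewrite mulf_neq0.
exists (\det T) => // m x /choice[h hP]; have [w wP] := basis_span es x.
pose W := \row_j ratr (w j) : 'rV[algC]_n.
have WT : W *m map_mx intr T = \row_k (\det T * m * h k)%:~R.
  rewrite TV; apply/rowP => k; rewrite !mxE -hP wP mulr_suml /field_trace.
  under [RHS]eq_bigr do rewrite rmorph_sum.
  rewrite exchange_big /=; apply: eq_bigr => j _; rewrite TE mxE mulr_sumr.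
  by apply: eq_bigr => i _; rewrite !rmorphM rmorphZ_num mulrA.
(* Multiplying [WT] by the adjugate of [T] gives [\det T] times [W] on the left, and the same factor
   cancels on the right. *)
have wm j : w j = (m * \sum_k h k * (\adj T) k j)%:~R.
  apply: (fmorph_inj (ratr : {rmorphism rat -> algC})); rewrite /= ratr_int.
  apply: (@mulfI _ (\det T)%:~R); first by rewrite intr_eq0.
  have /rowP/(_ j) := congr1 (mulmx^~ (map_mx intr (\adj T))) WT.
  rewrite -mulmxA -map_mxM mul_mx_adj map_scalar_mx mul_mx_scalar !mxE => ->.
  rewrite -intrM mulrA mulr_sumr rmorph_sum; apply: eq_bigr => k _.
  by rewrite !mxE -intrM !mulrA.
exists (\sum_j (\sum_k h k * (\adj T) k j)%:~R * e j).
  have [i] := emb_index; apply/(ring_of_integers_emb (s i)).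
  rewrite rmorph_sum rpred_sum // => j _; rewrite rmorphM rmorph_int.
  by rewrite rpredM ?Aint_int //; apply/ring_of_integers_emb/(basis_int es).
rewrite wP mulr_sumr; apply: eq_bigr => j _.
by rewrite wm -mulr_algl -in_algE rmorph_int intrM mulrA.
Qed.

End EmbeddingBasis.

(** * Closure properties of total positivity *)

Section TotallyPositive.

Variable K : fieldExtType rat.
Implicit Types x y : K.

Lemma totally_positiveD x y :
  totally_positive x -> totally_positive y -> totally_positive (x + y).
Proof. by move=> xp yp t tr; rewrite rmorphD addr_gt0 ?xp ?yp. Qed.

Lemma totally_positiveM x y :
  totally_positive x -> totally_positive y -> totally_positive (x * y).
Proof. by move=> xp yp t tr; rewrite rmorphM mulr_gt0 ?xp ?yp. Qed.

Lemma totally_positiveV x : totally_positive x -> totally_positive x^-1.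
Proof. by move=> xp t tr; rewrite fmorphV invr_gt0 xp. Qed.

Lemma totally_positive_sqr x : x != 0 -> totally_positive (x ^+ 2).
Proof.
move=> x0 t tr; rewrite rmorphXn /= lt0r sqrf_eq0 fmorph_eq0 x0.
by rewrite -realEsqr tr.
Qed.

End TotallyPositive.

(** * Elements of large norm and elements of bounded norm *)

Section TotallyReal.

Variables (K : fieldExtType rat) (n : nat) (e : 'I_n -> K).
Variable s : 'I_n -> {rmorphism K -> algC}.
Hypotheses (es : embedding_basis e s) (K_real : totally_real K).

Lemma totally_positive_emb (x : K) :
  totally_positive x <-> forall i, 0 < s i x.
Proof.
split=> [xp i|xp t _]; first exact/xp/K_real.
by have [i ->] := emb_complete es t.
Qed.

Lemma totally_positive_neq0 (x : K) : totally_positive x -> x != 0.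
Proof.
move=> /totally_positive_emb xp; have [i] := emb_index es.
by rewrite -(fmorph_eq0 (s i)) gt_eqF.
Qed.

Lemma field_norm_gt0 (x : K) : totally_positive x -> 0 < field_norm s x.
Proof. by move=> /totally_positive_emb xp; apply: prodr_gt0. Qed.

Lemma field_trace_gt0 (x : K) : totally_positive x -> 0 < field_trace s x.
Proof.
move=> /totally_positive_emb xp; have [i] := emb_index es.
rewrite /field_trace (bigD1 i) //= ltr_wpDr //.
by apply: sumr_ge0 => j _; apply: ltW.
Qed.

Lemma subtract_square (a : K) : totally_positive a ->
  exists B : nat, forall x, totally_positive x -> B%:R < field_norm s x ->
  exists y : K,
    [/\ ring_of_integers y, y != 0 & totally_positive (x - a * y ^+ 2)].
Proof.
move=> a_pos; have /totally_positive_emb ap := a_pos.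
have [|C CP] := @small_integer_combination _ n (fun i j => s i (e j)).
  by move=> i j; apply: K_real.
have Na := field_norm_gt0 a_pos.
(* The squares of the box sides [t i] chosen below multiply to [N(x) / N(a)]; this exceeds [C ^ 2]
   when [N(x)] exceeds [C ^ 2 N(a)]. *)
exists (Num.bound (C%:R ^+ 2 * field_norm s a)) => x /totally_positive_emb xp Nx.
pose t i := sqrtC (s i x / s i a).
have [i||c [j cj] ct] := CP t.
- by rewrite sqrtC_gt0 divr_gt0.
- have tge0 : 0 <= \prod_i t i.
    by apply: prodr_ge0 => i _; rewrite sqrtC_ge0 divr_ge0 ?ltW.
  rewrite -(@ltr_pXn2r _ 2%N) ?nnegrE ?ler0n //.
  rewrite -prodrXl; under eq_bigr do rewrite sqrtCK.
  rewrite prodf_div ltr_pdivlMr //; apply: lt_trans Nx.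
  by rewrite archi_boundP // mulr_ge0 ?exprn_ge0 ?ler0n // ltW.
pose y := \sum_j (c j)%:~R * e j.
have syE i : s i y = \sum_j (c j)%:~R * s i (e j).
  by rewrite rmorph_sum; apply: eq_bigr => k _; rewrite rmorphM rmorph_int.
exists y; split.
- have [i] := emb_index es; apply/(ring_of_integers_emb (s i)); rewrite syE.
  apply: rpred_sum => k _; rewrite rpredM ?Aint_int //.
  exact/ring_of_integers_emb/(basis_int es).
(* If [y] vanished, the invertible embedding matrix would force all coefficients [c k] to vanish. *)
- apply: contraNneq cj => y0.
  have cV : \row_k (c k)%:~R *m (\matrix_(i, k) s i (e k))^T = 0 :> 'rV[algC]_n.
    apply/rowP => i; rewrite !mxE -[RHS](rmorph0 (s i)) -y0 syE.
    by apply: eq_bigr => k _; rewrite !mxE.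
  have := emb_unitmx es; rewrite -unitmx_tr => Vu.
  have /rowP/(_ j) := congr1 (mulmx^~ (invmx (\matrix_(i, k) s i (e k))^T)) cV.
  by rewrite mulmxK // mul0mx !mxE => /eqP; rewrite intr_eq0.
- apply/totally_positive_emb => i; rewrite rmorphB rmorphM rmorphXn subr_gt0 /=.
  rewrite -ltr_pdivlMl // mulrC -[ltRHS]sqrtCK -/(t i).
  rewrite -real_normK ?K_real // ltr_pXn2r ?nnegrE //; last first.
    by rewrite sqrtC_ge0 divr_ge0 ?ltW.
  by rewrite syE ct.
Qed.

(* If [v - u] is a multiple of [N(u)], hence of [u], then [v / u] is integral.
   The norm of [u] divides [B`!], so it suffices to know [u] modulo [B`!]. *)
Lemma bounded_norm_classes (B : nat) : exists (T : finType) (f : K -> T),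
  forall u v, ring_of_integers u -> ring_of_integers v ->
    totally_positive u -> totally_positive v ->
    field_norm s u <= B%:R -> f u = f v -> ring_of_integers (v / u).
Proof.
have [d d0 dP] := trace_lattice_dvd es.
pose M := `|(d * B`!%:Z)%R|%N.
(* The traces of integers are integers, so [Num.floor] loses nothing; their residues modulo
   [d * B]![are what]dP[needs to place]v - u[in]B[!] times the ring of integers. *)
pose f u k := `|(Num.floor (field_trace s (u * e k)) %% (d * B`!%:Z)%R)%Z|%N.
exists {ffun 'I_n -> 'I_M.+1}, (fun u => [ffun k => inord (f u k)]).
move=> u v u_int v_int up vp Nu /ffunP fuv.
have [y y_int yE] : exists2 y : K, ring_of_integers y & v - u = B`!%:Z%:~R * y.
  apply: dP => k; move: (fuv k); rewrite !ffunE => /(congr1 val).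
  have d'0 : d * B`!%:Z != 0 by rewrite mulf_neq0 // eqz_nat -lt0n fact_gt0.
  have f_lt w : (f w k < M.+1)%N.
    by rewrite ltnS -lez_nat gez0_abs ?modz_ge0 // ltW ?ltz_mod // mulf_neq0.
  rewrite /= !inordK // => /(congr1 Posz).
  rewrite !gez0_abs ?modz_ge0 // => /esym/eqP; rewrite eqz_mod_dvd => /dvdzP[h hE].
  exists h; rewrite [d * _ * h]mulrC -hE intrB.
  have tr_int w : ring_of_integers w -> field_trace s (w * e k) \is a Num.int.
    by move=> w_int; apply/(field_trace_int es)/integral_mul/(basis_int es).
  rewrite !floorK ?tr_int //.
  by rewrite /field_trace -sumrB; apply: eq_bigr => i _; rewrite mulrBl rmorphB.
have u0 := totally_positive_neq0 up.
have /natrP[N NE] : field_norm s u \is a Num.nat.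
  rewrite -intrEge0; first exact: field_norm_int es _ u_int.
  exact/ltW/field_norm_gt0.
have N_dvd : (N %| B`!)%N.
  rewrite dvdn_fact // -(ltr0n algC) -NE field_norm_gt0 //=.
  by rewrite -(ler_nat algC) -NE.
have -> : v / u = 1 + ((B`! %/ N)%N%:Z)%:~R * (N%:Z%:~R / u) * y.
  rewrite -[v](subrK u) yE addrC mulrDl divff // -{1}(divnK N_dvd); congr (_ + _).
  by rewrite PoszM intrM -!mulrA; congr (_ * (_ * _)); rewrite mulrC.
apply: integral_add; first exact: integral1.
apply: integral_mul => //; apply: integral_mul; first exact: integral_id.
exact: (field_norm_dvd (m := N) es u_int u0 NE).
Qed.

End TotallyReal.

(** * Indecomposables of a fractional ideal and their classes *)

Section FractionalIdeal.

Variables (K : fieldExtType rat) (I : set K).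
Hypotheses (K_real : totally_real K) (I_ideal : nonzero_fractional_ideal I).

Lemma pos_partD (b c : K) : pos_part I b -> pos_part I c -> pos_part I (b + c).
Proof.
move=> [Ib bp] [Ic cp]; split; first exact: fideal_add.
exact: totally_positiveD.
Qed.

Lemma pos_denominator : exists D : K, [/\ ring_of_integers D,
  totally_positive D & forall x, I x -> ring_of_integers (D * x)].
Proof.
have [d [d_int d0 dI]] := fideal_denominator I_ideal.
exists (d ^+ 2); split; first exact: integral_mul.
  exact: totally_positive_sqr.
by move=> x /dI dx; rewrite expr2 -mulrA; apply: integral_mul.
Qed.

(** The square of [d x] is totally positive, and lies in [I] as the integer [d x d] times [x]. *)
Lemma pos_part_inhabited : exists a, pos_part I a.
Proof.
have [d [d_int d0 dI]] := fideal_denominator I_ideal.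
have [x Ix x0] := fideal_nonzero I_ideal.
exists ((d * x) ^+ 2); split; last by apply: totally_positive_sqr; rewrite mulf_neq0.
rewrite expr2 mulrA; apply: (fideal_mul I_ideal) => //.
by apply: integral_mul => //; apply: dI.
Qed.

(** Strong induction on the trace of [D x], a positive integer for [x] in [I^+]: both parts of a
    decomposition have a smaller trace. *)
Lemma indecomposable_ind (P : K -> Prop) :
    (forall a, indecomposable I a -> P a) ->
    (forall b c, pos_part I b -> pos_part I c -> P b -> P c -> P (b + c)) ->
  forall x, pos_part I x -> P x.
Proof.
move=> Pindec PD.
have [n [e [s es]]] := embedding_basis_exists K.
have [D [D_int Dp DI]] := pos_denominator.
have tr_nat x : pos_part I x ->
    exists2 m : nat, field_trace s (D * x) = m%:R & (0 < m)%N.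
  move=> [Ix xp]; have tr0 : 0 < field_trace s (D * x).
    by apply: (field_trace_gt0 es K_real); apply: totally_positiveM.
  have /natrP[m mE] : field_trace s (D * x) \is a Num.nat.
    rewrite -intrEge0 ?ltW //; apply: (field_trace_int es); exact: DI.
  by exists m; rewrite // -(ltr0n algC) -mE.
move=> x xI; have [m mE _] := tr_nat x xI.
elim/ltn_ind: m x xI mE => m IHm x xI mE.
have [[b [c [bI cI xE]]]|x_indec] :=
  pselect (exists b c : K, [/\ pos_part I b, pos_part I c & x = b + c]); last first.
  by apply: Pindec; split.
have [p pE p0] := tr_nat b bI; have [q qE q0] := tr_nat c cI.
have mpq : m = (p + q)%N.
  apply/eqP; rewrite -(eqr_nat algC) -mE natrD -pE -qE -big_split /= xE.
  by apply/eqP; apply: eq_bigr => i _; rewrite mulrDr rmorphD.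
rewrite xE; apply: PD => //; [apply: IHm pE | apply: IHm qE] => //.
  by rewrite mpq -addn1 leq_add2l.
by rewrite mpq -add1n leq_add2r.
Qed.

Lemma indecomposable_classes_finite : finite_set (indecomposable_classes I).
Proof.
have [n [e [s es]]] := embedding_basis_exists K.
have [D [D_int Dp DI]] := pos_denominator.
have [a [Ia ap]] := pos_part_inhabited.
have [B BP] := subtract_square es K_real ap.
have norm_le x : indecomposable I x -> field_norm s x <= B%:R.
  move=> [[Ix xp] x_indec].
  have Nreal := gtr0_real (field_norm_gt0 es K_real xp).
  rewrite real_leNgt ?realn //; apply/negP => Bx.
  have [y [y_int y0 xy]] := BP _ xp Bx.
  have Iay : I (a * y ^+ 2).
    by rewrite mulrC; apply: (fideal_mul I_ideal) => //; apply: integral_mul.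
  apply: x_indec; exists (a * y ^+ 2), (x - a * y ^+ 2); split.
  - by split=> //; apply: totally_positiveM => //; apply: totally_positive_sqr.
  - split=> //; apply: (fideal_add I_ideal) => //; rewrite -mulN1r.
    by apply: (fideal_mul I_ideal) => //; apply/integral_opp/integral1.
  - by rewrite addrC subrK.
(* Multiplication by [D] moves indecomposables into the ring of integers, with norm at most
   [N(D) B], and leaves their ratios unchanged. *)
have [T [f fP]] :=
  bounded_norm_classes es K_real (Num.bound (field_norm s D * B%:R)).
have ratio_int x y : indecomposable I x -> indecomposable I y ->
    f (D * x) = f (D * y) -> ring_of_integers (y / x).
  move=> xI yI; have [[Ix xp] _] := xI; have [[Iy yp] _] := yI.
  move=> /fP; rewrite -mulf_div divff ?mul1r; last exact: (totally_positive_neq0 es).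
  apply; [exact: DI | exact: DI | exact: totally_positiveM
    | exact: totally_positiveM |].
  rewrite /field_norm; under eq_bigr do rewrite rmorphM; rewrite big_split /=.
  apply: ltW; apply: le_lt_trans (archi_boundP _); last first.
    by rewrite mulr_ge0 ?ler0n // ltW // (field_norm_gt0 es K_real).
  by rewrite ler_pM2l ?norm_le // (field_norm_gt0 es K_real).
(* Equal values of [f] make both [x / y] and [y / x] integral, so [x / y] is a totally positive
   unit. *)
have orbit_sub x y z : indecomposable I x -> indecomposable I y ->
    f (D * x) = f (D * y) -> pos_unit_orbit x z -> pos_unit_orbit y z.
  move=> xI yI fxy [u [u_int ui_int up] <-].
  have [[_ xp] _] := xI; have [[_ yp] _] := yI.
  exists (u * (x / y)); last first.
    by rewrite -mulrA divfK //; exact: (totally_positive_neq0 es).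
  split; first by apply: integral_mul => //; apply: ratio_int.
    by rewrite invfM invf_div; apply: integral_mul => //; apply: ratio_int.
  by apply/totally_positiveM/totally_positiveM/totally_positiveV.
(* The union of all orbits with invariant [t]. By [orbit_sub] these orbits coincide, so every class
   is a value of [g] on the finite type [T]. *)
pose g t : set K := [set z | exists x,
  [/\ indecomposable I x, f (D * x) = t & pos_unit_orbit x z]].
apply: (@sub_finite_set _ _ (g @` setT)); last exact/finite_image/finite_finset.
move=> _ [x xI <-]; exists (f (D * x)) => //.
rewrite eqEsubset; split=> z; last by exists x.
by move=> [y [yI fyx]]; apply: orbit_sub.
Qed.

(** Enumerating the finite set of classes gives one generator per class, a chosen representative;
    the length of the list is the cardinal used in [ecard]. *)
Lemma pos_generated_classes :
  pos_generated I (size (finmap.enum_fset (fset_set (indecomposable_classes I)))).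
Proof.
set A := indecomposable_classes I; set r := finmap.enum_fset (fset_set A).
have rA C : (C \in r) = (C \in A).
  by rewrite in_fset_set //; apply: indecomposable_classes_finite.
have /choice[alpha alphaP] : forall i : 'I_(size r),
    exists x, indecomposable I x /\ pos_unit_orbit x = nth set0 r i.
  move=> i; have : nth set0 r i \in r by rewrite mem_nth.
  by rewrite rA inE => -[x xI xE]; exists x.
exists alpha => [i|]; first by case: (alphaP i) => -[[]].
rewrite eqEsubset; split=> x.
  case=> [xI|->]; last first.
    exists (fun=> 0); first by right.
    by rewrite big1 // => i _; rewrite mulr0.
  elim/indecomposable_ind: x / xI => [a aI|b c _ _ [v vP ->] [w wP ->]].
    have : pos_unit_orbit a \in r by rewrite rA inE; exists a.
    move=> /(nthP set0)[k kr kE]; have [_ alphaE] := alphaP (Ordinal kr).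
    (* Since 1 is a totally positive unit, [a] lies in its own orbit, hence is a unit multiple of
       the representative. *)
    have : nth set0 r k a.
      rewrite kE; exists 1; last by rewrite mul1r.
      split; [exact: integral1 | by rewrite invr1; exact: integral1|].
      by move=> t _; rewrite rmorph1 ltr01.
    rewrite -[k]/(val (Ordinal kr)) -alphaE => -[u [u_int _ up] <-].
    exists (fun i => if i == Ordinal kr then u else 0).
      by move=> i; case: ifP => _; [left | right].
    rewrite (bigD1 (Ordinal kr)) //= eqxx big1 ?addr0 1?mulrC // => i /negPf->.
    by rewrite mulr0.
  exists (fun i => v i + w i) => [i|]; last first.
    by rewrite -big_split; apply: eq_bigr => i _; rewrite mulrDr.
  case: (vP i) (wP i) => [[vi vp]|->] [[wi wp]|->]; rewrite ?addr0 ?add0r;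
    try by [right | left].
  by left; split; [apply: integral_add | apply: totally_positiveD].
(* Conversely, each term [alpha i * b i] is 0 or in [I^+], and partial sums stay in [I^{+,0}]. *)
case=> b bP ->; elim/big_rec: _ => [|i y _ yI]; first by right.
have [[[Ia ap] _] _] := alphaP i.
case: (bP i) yI => [[bi bp] yI|-> ]; last by rewrite mulr0 add0r.
have abI : pos_part I (alpha i * b i).
  split; last exact: totally_positiveM.
  by rewrite mulrC; apply: fideal_mul.
by case: yI => [yI|->]; left; [apply: pos_partD | rewrite addr0].
Qed.

End FractionalIdeal.

Theorem proposition3p5 (K : fieldExtType rat) (I : set K)
    (K_real : totally_real K) (I_ideal : nonzero_fractional_ideal I) :
  (kappa I <= ecard (indecomposable_classes I))%E /\ (kappa I < +oo)%E.
Proof.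
have gen := pos_generated_classes K_real I_ideal.
have fin := indecomposable_classes_finite K_real I_ideal.
rewrite /kappa /ecard; case: (pselect (exists _, _)) => [ex_n|]; last first.
  by case; eexists; apply/asboolP; exact: gen.
split; last exact: ltry.
have -> : pselect (finite_set (indecomposable_classes I)) = left fin.
  by case: (pselect _) => [?|/(_ fin) //]; congr left; apply: Prop_irrelevance.
rewrite /=; case: ex_minnP => m _ m_min.
by rewrite lee_fin lez_nat m_min //; apply/asboolP.
Qed.
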